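(* Let $f:\mathbb{R}^n\to\mathbb{R}$ and $c:\mathbb{R}^n\to\mathbb{R}^m$ be continuously differentiable with locally Lipschitz continuous derivatives, let $g:\mathbb{R}^n\to\mathbb{R}\cup\{\infty\}$ be proper, lower semicontinuous and prox-bounded, let $D\subset\mathbb{R}^m$ be nonempty and closed, and put $q:=f+g$. Consider a sequence $\{(x^k,s^k)\}_{k\in\mathbb{N}}$ of iterates generated by the augmented Lagrangian method (described in the context) with tolerances satisfying $\varepsilon_k\to 0$. Let $(x^*,c(x^* ))$ be an accumulation point of $\{(x^k,s^k)\}$ that is feasible for the problem of minimizing $q(x)$ over $(x,s)\in\mathbb{R}^n\times\mathbb{R}^m$ subject to $c(x)-s=0$, $s\in D$ (that is, $x^*\in\operatorname{dom} q$ and $c(x^* )\in D$), and let $\{(x^k,s^k)\}_{k\in K}$ be a subsequence such that, as $k\to\infty$ in $K$, $x^k\to x^*$ with $q(x^k)\to q(x^* )$, and $s^k\to c(x^* )$. Assume furthermore that $x^*$ is asymptotically M-regular (AM-regular) for the problem of minimizing $q(x)$ subject to $c(x)\in D$. Then $x^*$ is an M-stationary point of this problem.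
   Context: **Basic notions.** For $h:\mathbb{R}^N\to\mathbb{R}\cup\{\infty\}$, $\operatorname{dom}h=\{x: h(x)<\infty\}$; $h$ is proper if $\operatorname{dom}h\neq\emptyset$, and prox-bounded if it is proper and $h+\|\cdot\|^2/(2\gamma)$ is bounded below for some $\gamma>0$. For $h$ proper and lower semicontinuous and $\bar x\in\operatorname{dom}h$, the regular subdifferential is $\hat\partial h(\bar x)=\{v:\liminf_{x\to\bar x,\,x\ne\bar x}\frac{h(x)-h(\bar x)-\langle v,x-\bar x\rangle}{\|x-\bar x\|}\ge 0\}$, and the (limiting) subdifferential $\partial h(\bar x)$ is the set of $v$ for which there are $x^j\to\bar x$ with $h(x^j)\to h(\bar x)$ and $v^j\in\hat\partial h(x^j)$ with $v^j\to v$; both are empty if $\bar x\notin\operatorname{dom}h$. For closed nonempty $D\subset\mathbb{R}^m$ with projection $\Pi_D(v)=\operatorname{argmin}_{z\in D}\|z-v\|$, the limiting normal cone at $z\in D$ is $\mathcal N_D^{\lim}(z)=\limsup_{v\to z}\operatorname{cone}(v-\Pi_D(v))$ (outer limit: all limits of $w^j\in\operatorname{cone}(v^j-\Pi_D(v^j))$ with $v^j\to z$), and $\mathcal N_D^{\lim}(z)=\emptyset$ for $z\notin D$. $\nabla c(x)\in\mathbb{R}^{m\times n}$ denotes the Jacobian. **M-stationarity.** A point $x^*$ with $x^*\in\operatorname{dom}q$, $c(x^* )\in D$ is (Mordukhovich-, or) M-stationary for ''minimize $q(x)$ subject to $c(x)\in D$'' if there is $y^*\in\mathbb{R}^m$ with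 $-\nabla c(x^* )^\top y^*\in\partial q(x^* )$ and $y^*\in\mathcal N_D^{\lim}(c(x^* ))$. **AM-regularity.** Define $\mathcal M(x,z):=\partial g(x)+\nabla c(x)^\top\mathcal N_D^{\lim}(c(x)-z)\subset\mathbb{R}^n$ for $(x,z)\in\mathbb{R}^n\times\mathbb{R}^m$. A feasible point $x^*$ ($x^*\in\operatorname{dom}q$, $c(x^* )\in D$) is asymptotically M-regular (AM-regular) if every $v\in\mathbb{R}^n$ that is a limit of some $v^j\in\mathcal M(x^j,z^j)$ with $x^j\to x^*$, $g(x^j)\to g(x^* )$, $z^j\to0$ belongs to $\mathcal M(x^*,0)$. **Augmented Lagrangian.** For $\mu>0$, with $\delta_D$ the indicator function of $D$ ($0$ on $D$, $\infty$ elsewhere), $\mathcal L^S_\mu(x,s,y)=q(x)+\delta_D(s)+\langle y,c(x)-s\rangle+\frac1{2\mu}\|c(x)-s\|^2$. For $\varepsilon\ge0$, $(x,s)$ is an $\varepsilon$-stationary point of $\mathcal L^S_\mu(\cdot,\cdot,y)$ if there is $\eta$ in the limiting subdifferential of the function $\mathcal L^S_\mu(\cdot,\cdot,y)$ at $(x,s)$ with $\|\eta\|\le\varepsilon$. **Augmented Lagrangian method.** Fix $\mu_0>0$, $\theta,\kappa\in(0,1)$ and a nonempty bounded set $Y\subset\mathbb{R}^m$. For $k=0,1,2,\dots$: (1) select $\hat y^k\in Y$ and $\varepsilon_k\ge0$; (2) compute an $\varepsilon_k$-stationary point $(x^k,s^k)\in\mathbb{R}^n\times D$ of $\mathcal L^S_{\mu_k}(\cdot,\cdot,\hat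 y^k)$; (3) set $y^k=\hat y^k+[c(x^k)-s^k]/\mu_k$; (4) if $k=0$ or $\|c(x^k)-s^k\|\le\theta\|c(x^{k-1})-s^{k-1}\|$, set $\mu_{k+1}=\mu_k$; otherwise select $\mu_{k+1}\in(0,\kappa\mu_k]$. It is assumed that the method is well defined, i.e. each step (2) can be carried out, so that an infinite sequence is generated. *)

(* Defs.v *)
From HB Require Import structures.
From mathcomp Require Import all_boot all_order all_algebra.
From mathcomp Require Import all_classical all_reals all_analysis.

Set Implicit Arguments.
Unset Strict Implicit.
Unset Printing Implicit Defensive.

Import Order.TTheory GRing.Theory Num.Theory.
Import numFieldNormedType.Exports.

Local Open Scope classical_set_scope.
Local Open Scope ring_scope.

(** Vectors are row vectors.  The library norm [`|u|] on ['rV[R]_n] is the sup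
    norm: it only provides the topology (limits, boundedness, Lipschitz
    continuity), which it shares with the Euclidean norm [enorm].  Projections,
    subgradients, stationarity and the penalty use [enorm]. *)

Definition dot (R : realType) n (u v : 'rV[R]_n) : R :=
  \sum_(i < n) u 0 i * v 0 i.

Definition enorm (R : realType) n (u : 'rV[R]_n) : R := Num.sqrt (dot u u).

Section smoothness.
Context {R : realType}.

Definition grad n (f : 'rV[R]_n -> R) (x : 'rV[R]_n) : 'rV[R]_n :=
  \row_i 'D_(delta_mx 0 i) f x.

(** With row vectors ['d c x v = v *m 'J c x], so ['J c x] is the transpose of
    the usual [m * n] matrix of partial derivatives.  This is the row vector
    representing [(nabla c(x))^T y]. *)
Definition jacT_mul n m (c : 'rV[R]_n -> 'rV[R]_m) (x : 'rV[R]_n)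
    (y : 'rV[R]_m) : 'rV[R]_n := y *m ('J c x)^T.

Definition locally_lipschitz (V W : normedModType R) (F : V -> W) : Prop :=
  forall x : V, exists2 U : set V, nbhs x U & [lipschitz F z | z in U].

End smoothness.

(** Functions with values in the reals extended by [+oo] are maps into
    [\bar R]; that they avoid [-oo] is a separate hypothesis. *)
Section subdifferentials.
Context {R : realType} {N : nat}.
Implicit Types (h : 'rV[R]_N -> \bar R) (x v : 'rV[R]_N).
Local Open Scope ereal_scope.

Definition edom h : set 'rV[R]_N := [set x | h x < +oo].

Definition proper_fun h : Prop := edom h !=set0.

Definition prox_bounded h : Prop :=
  proper_fun h /\
  exists2 gamma : R, (0 < gamma)%R &
    exists M : R, forall x, M%:E <= h x + (enorm x ^+ 2 / (2 * gamma))%:E.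

Definition diff_quot h xbar v x : \bar R :=
  (h x - h xbar - (dot v (x - xbar)%R)%:E) * ((enorm (x - xbar)%R)^-1)%:E.

(** [xbar^'] is the filter of punctured neighbourhoods of [xbar]. *)
Definition regular_subdiff h xbar : set 'rV[R]_N :=
  [set v | edom h xbar /\ 0 <= limf_einf (diff_quot h xbar v) xbar^'].

Definition limiting_subdiff h xbar : set 'rV[R]_N :=
  [set v | edom h xbar /\
    exists x_ v_ : nat -> 'rV[R]_N,
      [/\ x_ j @[j --> \oo] --> xbar,
          h (x_ j) @[j --> \oo] --> h xbar,
          forall j, regular_subdiff h (x_ j) (v_ j) &
          v_ j @[j --> \oo] --> v]].

End subdifferentials.

Section normal_cone.
Context {R : realType} {m : nat}.
Implicit Types (D : set 'rV[R]_m) (z v : 'rV[R]_m).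

Definition proj D v : set 'rV[R]_m :=
  [set z | D z /\ forall w, D w -> enorm (z - v) <= enorm (w - v)].

(** Conic hull in the sense of positive scalings only (no convexification). *)
Definition cone (A : set 'rV[R]_m) : set 'rV[R]_m :=
  [set t *: a | t in [set t : R | 0 <= t] & a in A].

Definition limiting_normal_cone D z : set 'rV[R]_m :=
  [set w | D z /\
    exists v_ w_ : nat -> 'rV[R]_m,
      [/\ v_ j @[j --> \oo] --> z,
          forall j, cone [set v_ j - p | p in proj D (v_ j)] (w_ j) &
          w_ j @[j --> \oo] --> w]].

Definition indicator D z : \bar R := if z \in D then 0%E else +oo%E.

End normal_cone.

Section constrained_problem.
Context {R : realType} {n m : nat}.
Implicit Types (f : 'rV[R]_n -> R) (q g : 'rV[R]_n -> \bar R).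
Implicit Types (c : 'rV[R]_n -> 'rV[R]_m) (D : set 'rV[R]_m).

Definition objective f g (x : 'rV[R]_n) : \bar R := ((f x)%:E + g x)%E.

Definition feasible q c D (x : 'rV[R]_n) : Prop := edom q x /\ D (c x).

Definition M_stationary q c D (x : 'rV[R]_n) : Prop :=
  feasible q c D x /\
  exists y : 'rV[R]_m,
    limiting_subdiff q x (- jacT_mul c x y) /\
    limiting_normal_cone D (c x) y.

Definition M_map g c D (x : 'rV[R]_n) (z : 'rV[R]_m) : set 'rV[R]_n :=
  [set u + jacT_mul c x y | u in limiting_subdiff g x
                          & y in limiting_normal_cone D (c x - z)].

Definition AM_regular f g c D (x : 'rV[R]_n) : Prop :=
  feasible (objective f g) c D x /\
  forall v : 'rV[R]_n,
    (exists (x_ : nat -> 'rV[R]_n) (z_ : nat -> 'rV[R]_m)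
            (v_ : nat -> 'rV[R]_n),
      [/\ forall j, M_map g c D (x_ j) (z_ j) (v_ j),
          v_ j @[j --> \oo] --> v,
          x_ j @[j --> \oo] --> x,
          g (x_ j) @[j --> \oo] --> g x &
          z_ j @[j --> \oo] --> (0 : 'rV[R]_m)]) ->
    M_map g c D x 0 v.

Definition aug_lagrangian q c D (mu : R) (x : 'rV[R]_n) (s y : 'rV[R]_m)
    : \bar R :=
  (q x + indicator D s
   + (dot y (c x - s)%R + (2 * mu)^-1 * enorm (c x - s)%R ^+ 2)%:E)%E.

(** The pair [(x, s)] is encoded as the row vector [row_mx x s]. *)
Definition eps_stationary q c D (mu eps : R) (y : 'rV[R]_m)
    (x : 'rV[R]_n) (s : 'rV[R]_m) : Prop :=
  exists2 eta : 'rV[R]_(n + m),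
    limiting_subdiff
      (fun w => aug_lagrangian q c D mu (lsubmx w) (rsubmx w) y)
      (row_mx x s) eta &
    enorm eta <= eps.

(** [AL_run ... x s] : the sequences form one infinite run of the augmented
    Lagrangian method with parameters [mu0], [theta], [kappa] and [Y]. *)
Record AL_run q c D (mu0 theta kappa : R) (Y : set 'rV[R]_m)
    (mu eps : nat -> R) (yhat y : nat -> 'rV[R]_m)
    (x : nat -> 'rV[R]_n) (s : nat -> 'rV[R]_m) : Prop := {
  AL_mu0 : mu 0%N = mu0 ;
  AL_yhat : forall k, Y (yhat k) ;
  AL_eps : forall k, 0 <= eps k ;
  AL_s : forall k, D (s k) ;
  AL_stationary : forall k,
    eps_stationary q c D (mu k) (eps k) (yhat k) (x k) (s k) ;
  AL_y : forall k, y k = yhat k + (mu k)^-1 *: (c (x k) - s k) ;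
  AL_mu : forall k,
    if (k == 0%N) || (enorm (c (x k) - s k) <=
                        theta * enorm (c (x k.-1) - s k.-1))
    then mu k.+1 = mu k
    else 0 < mu k.+1 <= kappa * mu k
}.

End constrained_problem.

(* Main.v *)
Require Import Defs.
From mathcomp Require Import all_boot all_order all_algebra.
From mathcomp Require Import all_classical all_reals all_analysis.
From mathcomp Require Import ring lra.

Set Implicit Arguments.
Unset Strict Implicit.
Unset Printing Implicit Defensive.

Import Order.TTheory GRing.Theory Num.Theory.
Import numFieldNormedType.Exports.

Local Open Scope classical_set_scope.
Local Open Scope ring_scope.

(** Let [L] be the augmented Lagrangian with penalty [mu] and multiplier
estimate [yhat].  A regular subgradient [(a, b)] of [L] at [(x, s)] splits into
its two blocks: restricting [L] to one block and removing the smooth terms by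
the exact sum rule, one finds, with [lam = yhat + (c x - s) / mu],

  - [a - grad f x - (nabla c x)^T lam] is a regular subgradient of [g] at [x];
  - [b + lam] is a regular normal of [D] at [s].

Regular normals are limiting normals, so the combination
[a - grad f x + (nabla c x)^T b], from which [lam] has disappeared, belongs to
[M_map g c D x (c x - s)] ([regular_aug_lagrangian_M_map]).  The multipliers,
which may be unbounded along the run, never enter: only the primal
quantities [x], [g x], [c x - s] and this combination do.

A limiting subgradient is a limit of regular ones, so an approximately
stationary iterate yields a point of the closure of the graph of [M_map],
taken together with the values of [g] ([limiting_aug_lagrangian_closure]).
Passing to the closure rather than to [M_map] itself makes a diagonal argument
and the outer semicontinuity of subdifferentials and normal cones
superfluous, because closures are closed.  Along the subsequence the residual
[eta] tends to [0] with the tolerances, the constraint violation tends to [0]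
because [x] and [s] tend to [xs] and [c xs], and [g x] tends to [g xs] by
continuity of [f]; hence [(xs, g xs, 0, - grad f xs)] is in that closure.
Asymptotic regularity says that [- grad f xs] is then in [M_map g c D xs 0],
and adding [grad f xs] to the subgradient of [g] turns this membership into
M-stationarity ([AM_regular_stationary]). *)

(** * Euclidean and sup norms on row vectors *)

Section euclidean.
Context {R : realType} {n : nat}.
Implicit Types u v w : 'rV[R]_n.

Lemma dotE u v : dot u v = (u *m v^T) 0 0.
Proof. by rewrite mxE; apply: eq_bigr => i _; rewrite mxE. Qed.

Lemma dotC u v : dot u v = dot v u.
Proof. by apply: eq_bigr => i _; rewrite mulrC. Qed.

Lemma dotDl u v w : dot (u + v) w = dot u w + dot v w.
Proof. by rewrite /dot -big_split; apply: eq_bigr => i _; rewrite mxE mulrDl. Qed.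

Lemma dotZl a u v : dot (a *: u) v = a * dot u v.
Proof. by rewrite /dot mulr_sumr; apply: eq_bigr => i _; rewrite mxE mulrA. Qed.

Lemma dotNl u v : dot (- u) v = - dot u v.
Proof. by rewrite -scaleN1r dotZl mulN1r. Qed.

Lemma dotBl u v w : dot (u - v) w = dot u w - dot v w.
Proof. by rewrite dotDl dotNl. Qed.

Lemma dotDr u v w : dot w (u + v) = dot w u + dot w v.
Proof. by rewrite dotC dotDl !(dotC _ w). Qed.

Lemma dotBr u v w : dot w (u - v) = dot w u - dot w v.
Proof. by rewrite dotC dotBl !(dotC _ w). Qed.

Lemma dotZr a u v : dot u (a *: v) = a * dot u v.
Proof. by rewrite dotC dotZl dotC. Qed.

Lemma dot0r u : dot u 0 = 0.
Proof. by rewrite -(subrr 0) dotBr subrr. Qed.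

Lemma dotvv_ge0 u : 0 <= dot u u.
Proof. by apply: sumr_ge0 => i _; rewrite -expr2 sqr_ge0. Qed.

Lemma enorm_ge0 u : 0 <= enorm u. Proof. exact: sqrtr_ge0. Qed.

Lemma enorm_sqr u : enorm u ^+ 2 = dot u u.
Proof. by rewrite sqr_sqrtr // dotvv_ge0. Qed.

Lemma rV_coord_le u i : `|u 0 i| <= `|u|.
Proof.
rewrite [leRHS]/Num.Def.normr/= mx_normrE.
by apply/bigmax_geP; right => /=; exists (0, i).
Qed.

Lemma norm_rV_le u (a : R) : 0 <= a -> (forall i, `|u 0 i| <= a) -> `|u| <= a.
Proof.
move=> a0 ua; rewrite [leLHS]/Num.Def.normr/= mx_normrE.
by apply: bigmax_le => // -[i j] _ /=; rewrite ord1.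
Qed.

Lemma norm_le_enorm u : `|u| <= enorm u.
Proof.
apply: norm_rV_le => [|i]; first exact: enorm_ge0.
rewrite -(@ler_pXn2r _ 2) ?nnegrE ?enorm_ge0 // enorm_sqr real_normK ?num_real //.
by rewrite /dot (bigD1 i) //= -expr2 lerDl sumr_ge0 // => j _; rewrite -expr2 sqr_ge0.
Qed.

Lemma norm_dot_le u v : `|dot u v| <= n%:R * `|u| * `|v|.
Proof.
apply: (le_trans (ler_norm_sum _ _ _)).
rewrite -mulrA -[n in n%:R]card_ord mulr_natl -sumr_const ler_sum // => i _.
by rewrite normrM ler_pM // rV_coord_le.
Qed.

(** The constant [n.+1] is cruder than [sqrt n], but it is positive in
    dimension zero as well, so that one may divide by it. *)
Lemma enorm_le_norm u : enorm u <= n.+1%:R * `|u|.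
Proof.
rewrite -(@ler_pXn2r _ 2) ?nnegrE ?enorm_ge0 ?mulr_ge0 // enorm_sqr.
rewrite (le_trans (ler_norm _)) // (le_trans (norm_dot_le u u)) //.
rewrite exprMn -mulrA -expr2 ler_wpM2r ?sqr_ge0 // -natrX ler_nat.
by rewrite expnS expn1 (leq_trans (leqnSn n)) // leq_pmulr.
Qed.

Lemma enorm_gt0 u : u != 0 -> 0 < enorm u.
Proof. by move=> u0; apply: lt_le_trans (norm_le_enorm u); rewrite normr_gt0. Qed.

Lemma cvg_rV (T : Type) (F : set_system T) {FF : Filter F}
    (u_ : T -> 'rV[R]_n) (l : 'rV[R]_n) :
  (forall i, u_ t 0 i @[t --> F] --> l 0 i) -> u_ t @[t --> F] --> l.
Proof.
move=> ul; apply/cvgrPdist_le => e e0.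
have : \forall t \near F, forall i, `|l 0 i - u_ t 0 i| <= e.
  apply: filter_forall => i; have /cvgrPdist_le/(_ e e0) := ul i; exact.
apply: filterS => t ut; apply: norm_rV_le; first exact: ltW.
by move=> i; rewrite !mxE.
Qed.

End euclidean.

Lemma cvg_mulmx_tr (R : realType) (T : Type) (F : set_system T)
    {FF : Filter F} m n (u_ : T -> 'rV[R]_m) (u : 'rV[R]_m)
    (A_ : T -> 'M[R]_(n, m)) (A : 'M[R]_(n, m)) :
  u_ t @[t --> F] --> u -> A_ t @[t --> F] --> A ->
  u_ t *m (A_ t)^T @[t --> F] --> u *m A^T.
Proof.
move=> uu AA; apply: cvg_rV => i.
have cvg_entry : forall k, u_ t 0 k * A_ t i k @[t --> F] --> u 0 k * A i k.
  move=> k; apply: cvgM.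
  - exact: (cvg_comp _ _ uu (@coord_continuous R 1 m 0 k u)).
  - exact: (cvg_comp _ _ AA (@coord_continuous R n m i k A)).
have mulE : forall (y : 'rV[R]_m) (B : 'M[R]_(n, m)),
    (y *m B^T) 0 i = \sum_k y 0 k * B i k.
  by move=> y B; rewrite mxE; apply: eq_bigr => k _; rewrite mxE.
rewrite mulE; under [X in X @ _]eq_fun do rewrite mulE.
elim: (index_enum _) => [|k r IH].
  by rewrite big_nil; under [X in X @ _]eq_fun do rewrite big_nil; apply: cvg_cst.
rewrite big_cons; under [X in X @ _]eq_fun do rewrite big_cons.
exact: cvgD (cvg_entry k) IH.
Qed.

Lemma cvg_dot (R : realType) (T : Type) (F : set_system T) {FF : Filter F} n
    (u_ v_ : T -> 'rV[R]_n) (u v : 'rV[R]_n) :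
  u_ t @[t --> F] --> u -> v_ t @[t --> F] --> v ->
  dot (u_ t) (v_ t) @[t --> F] --> dot u v.
Proof.
move=> uu vv; rewrite dotE; under [X in X @ _]eq_fun do rewrite dotE.
exact: (cvg_comp _ _ (cvg_mulmx_tr uu vv) (@coord_continuous R 1 1 0 0 _)).
Qed.

Lemma cvg_row_mx (R : realType) (T : Type) (F : set_system T) {FF : Filter F}
    n m (u_ : T -> 'rV[R]_n) (v_ : T -> 'rV[R]_m) (u : 'rV[R]_n)
    (v : 'rV[R]_m) :
  u_ t @[t --> F] --> u -> v_ t @[t --> F] --> v ->
  row_mx (u_ t) (v_ t) @[t --> F] --> row_mx u v.
Proof.
move=> uu vv; apply: cvg_rV => i; case: (split_ordP i) => k ->.
- rewrite row_mxEl; under [X in X @ _]eq_fun do rewrite row_mxEl.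
  exact: (cvg_comp _ _ uu (@coord_continuous R 1 n 0 k u)).
- rewrite row_mxEr; under [X in X @ _]eq_fun do rewrite row_mxEr.
  exact: (cvg_comp _ _ vv (@coord_continuous R 1 m 0 k v)).
Qed.

Lemma dot_row_mx (R : realType) n m (u u' : 'rV[R]_n) (v v' : 'rV[R]_m) :
  dot (row_mx u v) (row_mx u' v') = dot u u' + dot v v'.
Proof.
rewrite /dot big_split_ord; congr (_ + _); apply: eq_bigr => i _.
- by rewrite !row_mxEl.
- by rewrite !row_mxEr.
Qed.

Lemma norm_row_mx0_le (R : realType) n m (u : 'rV[R]_n) :
  `|row_mx u (0 : 'rV[R]_m)| <= `|u|.
Proof.
apply: norm_rV_le => // i; case: (split_ordP i) => k ->.
- by rewrite row_mxEl rV_coord_le.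
- by rewrite row_mxEr mxE normr0.
Qed.

Lemma norm_row_0mx_le (R : realType) n m (v : 'rV[R]_m) :
  `|row_mx (0 : 'rV[R]_n) v| <= `|v|.
Proof.
apply: norm_rV_le => // i; case: (split_ordP i) => k ->.
- by rewrite row_mxEl mxE normr0.
- by rewrite row_mxEr rV_coord_le.
Qed.

(** * Regular subgradients *)

(** Asymptotic regularity is stated with sequences, the main argument with
    closures; first countability links the two. *)
Lemma closure_cvg_seq (R : realType) (T : pseudoMetricType R) (A : set T) p :
  closure A p ->
  exists u_ : nat -> T, (forall j, A (u_ j)) /\ u_ j @[j --> \oo] --> p.
Proof.
move=> clA.
have /choice[u_ uP] : forall j : nat, exists u, A u /\ ball p (j.+1%:R^-1) u.
  move=> j; have [|u [Au pu]] := clA (ball p (j.+1%:R^-1 : R)); last by exists u.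
  by apply: nbhsx_ballx; rewrite invr_gt0.
exists u_; split=> [j|]; first by have [] := uP j.
apply/cvg_ballP => e e0.
have := near_infty_natSinv_lt (PosNum e0); apply: filterS => j /ltW je.
exact: (le_ball je (proj2 (uP j))).
Qed.

Section regular_subgradients.
Context {R : realType} {n : nat}.
Implicit Types (h : 'rV[R]_n -> \bar R) (x v : 'rV[R]_n).

(** Clearing the denominator of the difference quotient turns the lower limit
    into a first-order lower bound, which is stable under sums and
    restrictions.  All norms being equivalent, the sup norm may be used. *)
Lemma regular_subdiffP h x v : (forall z, (-oo < h z)%E) ->
  regular_subdiff h x v <->
  edom h x /\ forall e : R, 0 < e -> \forall z \near x,
    (h x + (dot v (z - x) - e * `|z - x|)%:E <= h z)%E.
Proof.
move=> hNy; split=> -[hx H]; split=> //.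
- have hxfin : (h x \is a fin_num)%E by rewrite fin_numElt hNy.
  move=> e e0; set K : R := n.+1%:R.
  have K0 : 0 < K by rewrite ltr0n.
  move: H; rewrite limf_einfE => H.
  have : ((- (e / K))%:E < ereal_sup [set ereal_inf (diff_quot h x v @` V) | V in x^'])%E.
    by apply: lt_le_trans H; rewrite lte_fin oppr_lt0 divr_gt0.
  move=> /ereal_sup_gt[_ [V xV <-]] Vinf.
  have {}xV : \forall z \near x, z != x -> V z.
    exact: xV.
  move: xV; apply: filterS => z Vz.
  have [->|zx] := eqVneq z x; first by rewrite subrr dot0r normr0 mulr0 subrr adde0.
  have : ((- (e / K))%:E < diff_quot h x v z)%E.
    by apply: lt_le_trans Vinf _; apply: ereal_inf_lbound; exists z => //; exact: Vz.
  have zx0 : 0 < enorm (z - x) by rewrite enorm_gt0 // subr_eq0.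
  rewrite /diff_quot; have := hNy z; move: hxfin.
  case: (h x) => // a _; case: (h z) => // [b _|_ _]; last by rewrite leey.
  rewrite -!EFinB -EFinM lte_fin -EFinD lee_fin ltr_pdivlMr // => Hz.
  have : e / K * enorm (z - x) <= e * `|z - x|.
    by rewrite -mulrA ler_pM2l // ler_pdivrMl // enorm_le_norm.
  move: Hz; rewrite mulNr.
  move: (e / K * enorm (z - x)) (dot v (z - x)) (e * `|z - x|) => p q r; lra.
- have hxfin : (h x \is a fin_num)%E by rewrite fin_numElt hNy.
  rewrite limf_einfE; apply/lee_subgt0Pr => e e0.
  rewrite sub0e -EFinN.
  have {}H := H e e0.
  apply: (@le_trans _ _ (ereal_inf (diff_quot h x v @`
    [set z | z != x /\ (h x + (dot v (z - x) - e * `|z - x|)%:E <= h z)%E]))).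
    apply: le_ereal_inf_tmp => _ [z /= [zx Hz] <-].
    have zx0 : 0 < enorm (z - x) by rewrite enorm_gt0 // subr_eq0.
    move: Hz hxfin; rewrite /diff_quot; have := hNy z.
    case: (h x) => // a; case: (h z) => // [b _|_ _ _]; last first.
      by rewrite /= gt0_mulye ?leey // lte_fin invr_gt0.
    rewrite -!EFinB -EFinM !lee_fin ler_pdivlMr // => Hz _.
    have : e * `|z - x| <= e * enorm (z - x) by rewrite ler_pM2l // norm_le_enorm.
    rewrite mulNr; move: (e * enorm (z - x)) (dot v (z - x)) (e * `|z - x|) Hz.
    move=> p q r; lra.
  apply: ereal_sup_ubound; eexists; last by [].
  by move: H; apply: filterS => z Hz zx.
Qed.

End regular_subgradients.

(** * Gradients *)

Section gradients.
Context {R : realType}.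

(** Frechet differentiability in the same epsilon form as
    [regular_subdiffP], so that the two combine by adding inequalities. *)
Definition has_gradient n (phi : 'rV[R]_n -> R) (x p : 'rV[R]_n) : Prop :=
  forall e : R, 0 < e -> \forall z \near x,
    `|phi z - phi x - dot p (z - x)| <= e * `|z - x|.

Lemma differential_bound n m (F : 'rV[R]_n -> 'rV[R]_m) (x : 'rV[R]_n) :
  differentiable F x -> forall e : R, 0 < e -> \forall z \near x,
    `|F z - F x - (z - x) *m 'J F x| <= e * `|z - x|.
Proof.
move=> dF e e0.
have /eqaddoP H := diff_locally dF; have {H} := H e e0.
rewrite [X in _ -> X](near_shift 0) subr0; apply: filterS => h.
by rewrite /= !fctE /= addrK opprD addrA /jacobian mul_rV_lin1.
Qed.

Lemma grad_has_gradient n (f : 'rV[R]_n -> R) (x : 'rV[R]_n) :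
  differentiable f x -> has_gradient f x (grad f x).
Proof.
move=> df e e0.
have dE u : 'd f x u = dot (grad f x) u.
  rewrite {1}(row_sum_delta u) linear_sum; apply: eq_bigr => i _.
  by rewrite linearZ mxE deriveE //= mulrC.
have /eqaddoP H := diff_locally df; have {H} := H e e0.
rewrite [X in _ -> X](near_shift 0) subr0; apply: filterS => h.
by rewrite /= !fctE /= addrK opprD addrA dE.
Qed.

Lemma dot_mulmx_tr n m (p : 'rV[R]_m) (u : 'rV[R]_n) (A : 'M[R]_(n, m)) :
  dot p (u *m A) = dot (p *m A^T) u.
Proof. by rewrite !dotE trmx_mul mulmxA. Qed.

Lemma has_gradient_comp n m (c : 'rV[R]_n -> 'rV[R]_m) (psi : 'rV[R]_m -> R)
    (x : 'rV[R]_n) (p : 'rV[R]_m) :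
  differentiable c x -> has_gradient psi (c x) p ->
  has_gradient (psi \o c) x (jacT_mul c x p).
Proof.
move=> dc dpsi e e0.
have cc : c z @[z --> x] --> c x by exact: differentiable_continuous.
have [k k0 Jk] : exists2 k : R, 0 < k & forall u : 'rV[R]_n, `|u *m 'J c x| <= k * `|u|.
  have [k k0 kP] := linear_lipschitz (@diff_continuous _ _ _ _ c dc).
  by exists k => // u; rewrite /jacobian mul_rV_lin1.
(* Half of [e] is spent on the remainder of [psi], evaluated at an increment
   of norm at most [(k + 1) |z - x|], and half on the remainder of [c], which
   is amplified by [dot p], a form of norm at most [C]. *)
set e1 := e / 2 / (k + 1); set C := m%:R * `|p|.
have C0 : 0 <= C by rewrite mulr_ge0.
set e2 := Num.min 1 (e / 2 / (C + 1)).
have e10 : 0 < e1 by rewrite !divr_gt0 // ltr_wpDl // ltW.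
have e20 : 0 < e2 by rewrite lt_min ltr01 !divr_gt0 // ltr_wpDl.
near=> z.
have r_le : `|c z - c x - (z - x) *m 'J c x| <= e2 * `|z - x|.
  by near: z; exact: differential_bound.
have psi_le : `|psi (c z) - psi (c x) - dot p (c z - c x)| <= e1 * `|c z - c x|.
  by near: z; exact: cc _ (dpsi _ e10).
move: r_le psi_le; rewrite /= /jacT_mul -dot_mulmx_tr.
set h := z - x; set d := c z - c x => r_le psi_le.
have d_le : `|d| <= (k + 1) * `|h|.
  rewrite -[d](subrK (h *m 'J c x)) (le_trans (ler_normD _ _)) //.
  rewrite mulrDl addrC lerD // mul1r (le_trans r_le) //.
  by rewrite ler_piMl // ge_min lexx.
have -> : psi (c z) - psi (c x) - dot p (h *m 'J c x) =
    (psi (c z) - psi (c x) - dot p d) + dot p (d - h *m 'J c x).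
  by rewrite (dotBr d); ring.
apply: (le_trans (ler_normD _ _)).
have -> : e * `|h| = e1 * ((k + 1) * `|h|) + e / 2 * `|h|.
  by rewrite /e1; field; rewrite gt_eqF // ltr_wpDl // ltW.
apply: lerD.
  by apply: (le_trans psi_le); rewrite ler_pM2l.
apply: (le_trans (norm_dot_le _ _)).
apply: (@le_trans _ _ (C * (e2 * `|h|))); first by rewrite ler_wpM2l.
rewrite mulrA ler_wpM2r //.
apply: (@le_trans _ _ (C * (e / 2 / (C + 1)))).
  by rewrite ler_wpM2l // ge_min lexx orbT.
rewrite mulrA ler_pdivrMr ?ltr_wpDl // mulrC ler_pM2l ?divr_gt0 //.
by rewrite lerDl.
Unshelve. all: by end_near. Qed.

Lemma has_gradient_add n (phi psi : 'rV[R]_n -> R) (x p q : 'rV[R]_n) :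
  has_gradient phi x p -> has_gradient psi x q ->
  has_gradient (fun z => phi z + psi z) x (p + q).
Proof.
move=> dphi dpsi e e0; have e20 : 0 < e / 2 by rewrite divr_gt0.
have := dphi _ e20; have := dpsi _ e20; apply: filterS2 => z Hq Hp.
rewrite /= [e]splitr mulrDl dotDl.
apply: le_trans (lerD Hp Hq); apply: le_trans (ler_normD _ _).
rewrite le_eqVlt; apply/orP; left; apply/eqP; congr (`|_|).
by rewrite !opprD (addrACA (phi z)) (addrACA (phi z - phi x)).
Qed.

Lemma has_gradient_opp n (phi : 'rV[R]_n -> R) (x p : 'rV[R]_n) :
  has_gradient phi x p -> has_gradient (fun z => - phi z) x (- p).
Proof.
move=> dphi e e0; have := dphi e e0; apply: filterS => z.
by rewrite /= dotNl -!opprD normrN.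
Qed.

(** The smooth coupling term of the augmented Lagrangian as a function of the
    residual [a = c x - s]. *)
Definition penalty m (mu : R) (y a : 'rV[R]_m) : R :=
  dot y a + (2 * mu)^-1 * enorm a ^+ 2.

(** The remainder of this quadratic is exactly [(2 mu)^-1 |w - z|^2]. *)
Lemma has_gradient_penalty m (mu : R) (y s z : 'rV[R]_m) :
  has_gradient (fun w => penalty mu y (w - s)) z (y + mu^-1 *: (z - s)).
Proof.
move=> e e0.
set C := `|(2 * mu)^-1| * m%:R; have C0 : 0 <= C by rewrite mulr_ge0.
have d0 : 0 < e / (C + 1) by rewrite divr_gt0 // ltr_wpDl.
near=> w.
have wz : `|w - z| <= e / (C + 1).
  by rewrite distrC; near: w; exact: cvgr_dist_le.
have -> : penalty mu y (w - s) - penalty mu y (z - s)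
    - dot (y + mu^-1 *: (z - s)) (w - z) = (2 * mu)^-1 * dot (w - z) (w - z).
  have -> : w - s = (w - z) + (z - s) by rewrite addrA subrK.
  rewrite /penalty !enorm_sqr invfM.
  move: (w - z) (z - s) => a b.
  rewrite !dotDl !dotDr dotZl (dotC b a).
  by move: (mu^-1) => r; field.
rewrite normrM (le_trans (ler_wpM2l _ (norm_dot_le _ _))) //.
rewrite !mulrA ler_wpM2r //.
apply: (@le_trans _ _ (C * (e / (C + 1)))); first by rewrite ler_wpM2l.
by rewrite mulrA ler_pdivrMr ?ltr_wpDl // mulrC ler_pM2l // lerDl.
Unshelve. all: by end_near. Qed.

(** Up to the sign of [y], the penalty is symmetric in [a] and [w]. *)
Lemma has_gradient_penalty_slack m (mu : R) (y a s : 'rV[R]_m) :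
  has_gradient (fun w => penalty mu y (a - w)) s (- (y + mu^-1 *: (a - s))).
Proof.
have -> : (fun w => penalty mu y (a - w)) = (fun w => penalty mu (- y) (w - a)).
  apply/funext => w; rewrite /penalty !enorm_sqr -opprB.
  by rewrite -[- (w - a)]scaleN1r !dotZr !dotZl dotNl; ring.
by rewrite opprD -scalerN opprB; exact: has_gradient_penalty.
Qed.

End gradients.

(** * Sum rule and slices of regular subdifferentials *)

Section regular_calculus.
Context {R : realType}.

Lemma addEFin_gtNy (a : \bar R) (b : R) : (-oo < a -> -oo < a + b%:E)%E.
Proof. by case: a => // r _; rewrite -EFinD ltNyr. Qed.

Lemma regular_subdiff_add n (h : 'rV[R]_n -> \bar R) (phi : 'rV[R]_n -> R)
    (x p v : 'rV[R]_n) :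
  (forall z, (-oo < h z)%E) -> has_gradient phi x p ->
  regular_subdiff h x v ->
  regular_subdiff (fun z => h z + (phi z)%:E)%E x (v + p).
Proof.
move=> hNy dphi /(regular_subdiffP _ _ hNy)[hx H].
have hphiNy z : (-oo < h z + (phi z)%:E)%E by apply: addEFin_gtNy.
apply/(regular_subdiffP _ _ hphiNy); split; first by rewrite /edom /= lte_add_pinfty // ltry.
move=> e e0; have e20 : 0 < e / 2 by rewrite divr_gt0.
have hxfin : (h x \is a fin_num)%E by rewrite fin_numElt hNy.
have := H _ e20; have := dphi _ e20; apply: filterS2 => z.
rewrite ler_norml => /andP[+ _]; have := hNy z; move: hxfin.
case: (h x) => // a _; case: (h z) => // [b _|_ _ _]; last by rewrite addye // leey.
rewrite -!EFinD !lee_fin dotDl.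
rewrite {3}[e]splitr mulrDl.
move: (dot v _) (dot p _) (e / 2 * _) => ? ? ?; lra.
Qed.

(** Exactness of the sum rule: subtracting the smooth term again recovers the
    subgradients of [h]. *)
Lemma regular_subdiff_sub n (h : 'rV[R]_n -> \bar R) (phi : 'rV[R]_n -> R)
    (x p v : 'rV[R]_n) :
  (forall z, (-oo < h z)%E) -> has_gradient phi x p ->
  regular_subdiff (fun z => h z + (phi z)%:E)%E x v ->
  regular_subdiff h x (v - p).
Proof.
move=> hNy dphi H.
have -> : h = (fun z => h z + (phi z)%:E + (- phi z)%:E)%E.
  by apply/funext => z; rewrite EFinN addeK.
apply: regular_subdiff_add H => [z|]; last exact: has_gradient_opp.
exact: addEFin_gtNy.
Qed.

(** Freezing one block keeps the corresponding block of a regular subgradient,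
    since the defining inequality is merely restricted to an affine subspace.
    The analogue for limiting subgradients fails, which is why blocks are
    separated before passing to the limit. *)
Lemma regular_subdiff_lslice n m (H : 'rV[R]_(n + m) -> \bar R)
    (w eta : 'rV[R]_(n + m)) :
  (forall z, (-oo < H z)%E) -> regular_subdiff H w eta ->
  regular_subdiff (fun z => H (row_mx z (rsubmx w))) (lsubmx w) (lsubmx eta).
Proof.
move=> HNy /(regular_subdiffP _ _ HNy)[Hw HP].
apply/regular_subdiffP => //; split; first by rewrite /edom /= hsubmxK.
move=> e e0.
have cvgw : row_mx z (rsubmx w) @[z --> lsubmx w] --> w.
  rewrite -[X in _ --> X]hsubmxK.
  exact: (cvg_row_mx (F := nbhs (lsubmx w)) (u_ := id) cvg_id (cvg_cst _)).
apply: (filterS (F := nbhs (lsubmx w)) _ (cvgw _ (HP _ e0))) => z /= Hz; apply: le_trans Hz.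
have -> : row_mx z (rsubmx w) - w = row_mx (z - lsubmx w) 0.
  by rewrite -{2}[w]hsubmxK opp_row_mx add_row_mx subrr.
rewrite hsubmxK leeD2l // lee_fin -[eta in leRHS]hsubmxK dot_row_mx dot0r addr0.
by rewrite lerD2l lerN2 ler_pM2l // norm_row_mx0_le.
Qed.

Lemma regular_subdiff_rslice n m (H : 'rV[R]_(n + m) -> \bar R)
    (w eta : 'rV[R]_(n + m)) :
  (forall z, (-oo < H z)%E) -> regular_subdiff H w eta ->
  regular_subdiff (fun z => H (row_mx (lsubmx w) z)) (rsubmx w) (rsubmx eta).
Proof.
move=> HNy /(regular_subdiffP _ _ HNy)[Hw HP].
apply/regular_subdiffP => //; split; first by rewrite /edom /= hsubmxK.
move=> e e0.
have cvgw : row_mx (lsubmx w) z @[z --> rsubmx w] --> w.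
  rewrite -[X in _ --> X]hsubmxK.
  exact: (cvg_row_mx (F := nbhs (rsubmx w)) (v_ := id) (cvg_cst _) cvg_id).
apply: (filterS (F := nbhs (rsubmx w)) _ (cvgw _ (HP _ e0))) => z /= Hz; apply: le_trans Hz.
have -> : row_mx (lsubmx w) z - w = row_mx 0 (z - rsubmx w).
  by rewrite -{2}[w]hsubmxK opp_row_mx add_row_mx subrr.
rewrite hsubmxK leeD2l // lee_fin -[eta in leRHS]hsubmxK dot_row_mx dot0r add0r.
by rewrite lerD2l lerN2 ler_pM2l // norm_row_0mx_le.
Qed.

Lemma regular_sub_limiting n (h : 'rV[R]_n -> \bar R) x v :
  regular_subdiff h x v -> limiting_subdiff h x v.
Proof.
move=> hv; split; first by case: hv.
by exists (fun=> x), (fun=> v); split=> //; apply: cvg_cst.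
Qed.

End regular_calculus.

(** * Regular normals are limiting normals *)

Section normals.
Context {R : realType} {m : nat} (D : set 'rV[R]_m).
Hypothesis D_closed : closed D.

Lemma ler_of_mul_self (a b : R) : 0 <= a -> 0 <= b -> a * a <= b * a -> a <= b.
Proof.
rewrite le_eqVlt => /predU1P[<- //|a0] _.
by rewrite ler_pM2r.
Qed.

(** Minimize the distance over the part of [D] that is no farther from [v] than
    some [d] in [D]; this part is compact. *)
Lemma proj_nonempty (v : 'rV[R]_m) : D !=set0 -> Defs.proj D v !=set0.
Proof.
move=> [d Dd].
have dist_cont : continuous (fun w : 'rV[R]_m => dot (w - v) (w - v)).
  move=> w; have wv : (fun z : 'rV[R]_m => z - v) @ nbhs w --> (w - v : 'rV[R]_m).
    exact: (cvgB (F := nbhs w) (f := id) cvg_id (cvg_cst _)).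
  exact: (cvg_dot (F := nbhs w) wv wv).
pose A := D `&` [set w | dot (w - v) (w - v) <= dot (d - v) (d - v)].
have A0 : A !=set0 by exists d; split=> /=.
have cA : compact A.
  apply: bounded_closed_compact.
    exists (`|v| + enorm (d - v)); split; first exact: num_real.
    move=> r lr w [_ wA]; apply: le_trans (ltW lr).
    rewrite -[w](subrK v) addrC (le_trans (ler_normD _ _)) // lerD2l.
    rewrite (le_trans (norm_le_enorm _)) //.
    by rewrite -(@ler_pXn2r _ 2) ?nnegrE ?enorm_ge0 // !enorm_sqr.
  apply: closedI => //.
  apply: (@closed_comp _ _ _ [set r | r <= _]); first by move=> ? _; exact: dist_cont.
  exact: closed_le.
have [p] := EVT_min_rV A0 cA (continuous_subspaceT dist_cont).
rewrite inE => -[Dp pd] pmin; exists p; split=> // w Dw.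
rewrite -(@ler_pXn2r _ 2) ?nnegrE ?enorm_ge0 // !enorm_sqr.
have [wd|/ltW dw] := leP (dot (w - v) (w - v)) (dot (d - v) (d - v)).
  by apply: pmin; rewrite inE.
exact: le_trans pd dw.
Qed.

(** Project [s + t *: v] onto [D] as [t] decreases to [0].  Comparing with the
    competitor [s] gives [|p - s|^2 <= 2 t <v, p - s>], so [p] tends to [s];
    regularity of [v] then makes [<v, p - s>] negligible against [|p - s|],
    whence [p - s = o(t)] and the scaled residuals [(s + t v - p) / t] tend
    to [v]. *)
Lemma regular_normal_limiting (s v : 'rV[R]_m) : D s ->
  (forall e : R, 0 < e -> \forall w \near s, D w -> dot v (w - s) <= e * `|w - s|) ->
  limiting_normal_cone D s v.
Proof.
move=> Ds Hv; split=> //.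
pose t j : R := j.+1%:R^-1.
have t0 j : 0 < t j by rewrite invr_gt0.
have /choice[p pP] : forall j, exists q, Defs.proj D (s + t j *: v) q.
  by move=> j; have [q qP] := proj_nonempty (s + t j *: v) (ex_intro _ s Ds); exists q.
have tcvg : t j @[j --> \oo] --> (0 : R) by exact: cvg_harmonic.
have dist_sq j : `|p j - s| * `|p j - s| <= 2 * t j * dot v (p j - s).
  have [_ /(_ _ Ds)] := pP j.
  rewrite -(@ler_pXn2r _ 2) ?nnegrE ?enorm_ge0 // !enorm_sqr.
  have -> : p j - (s + t j *: v) = (p j - s) - t j *: v by rewrite opprD addrA.
  have -> : s - (s + t j *: v) = - (t j *: v) by rewrite opprD addrA subrr add0r.
  have : `|p j - s| * `|p j - s| <= dot (p j - s) (p j - s).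
    rewrite -enorm_sqr expr2 ler_pM //; exact: norm_le_enorm.
  move: (p j - s) => a; rewrite -scaleN1r !(dotDl, dotDr, dotZl, dotZr) (dotC a v).
  move: (`|a| * `|a|) (dot a a) (dot v a) (dot v v) (t j) => ? ? ? ? ?; nra.
have pcvg : p j @[j --> \oo] --> s.
  pose C := 2 * (m%:R * `|v|).
  have p_le j : `|p j - s| <= C * t j.
    apply: ler_of_mul_self => //; first by rewrite !mulr_ge0 // ltW.
    rewrite (le_trans (dist_sq j)) // /C.
    rewrite -!mulrA ler_pM2l // [leRHS](_ : _ = t j * (m%:R * `|v| * `|p j - s|)).
      by rewrite ler_pM2l // (le_trans (ler_norm _)) // norm_dot_le.
    ring.
  apply/cvgrPdist_le => e e0.
  have Ct : C * t j @[j --> \oo] --> (0 : R).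
    by rewrite -(mulr0 C); apply: cvgMr.
  have /cvgrPdist_le/(_ e e0) := Ct; apply: filterS => j.
  rewrite sub0r normrN distrC => Cte; apply: le_trans (p_le j) (le_trans (ler_norm _) Cte).
exists (fun j => s + t j *: v), (fun j => (t j)^-1 *: (s + t j *: v - p j)); split.
- rewrite -[X in _ --> X]addr0 -[X in _ + X](scale0r v).
  by apply: cvgD; [exact: cvg_cst|apply: cvgZl].
- move=> j; exists (t j)^-1; first by rewrite /= invr_ge0 ltW.
  by exists (s + t j *: v - p j) => //; exists (p j).
- apply/cvgrPdist_le => e e0; have e20 : 0 < e / 2 by rewrite divr_gt0.
  apply: (filterS (F := \oo) _ (pcvg _ (Hv _ e20))) => j /= Hj.
  have [Dp _] := pP j; have {Hj} := Hj Dp.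
  rewrite scalerBr scalerDr scalerA mulVf ?gt_eqF // scale1r.
  have -> : v - ((t j)^-1 *: s + v - (t j)^-1 *: p j) = (t j)^-1 *: (p j - s).
    by rewrite scalerBr [_ + v]addrC -addrA opprD addrA subrr add0r opprB.
  rewrite normrZ ger0_norm; last by rewrite invr_ge0 ltW.
  rewrite ler_pdivrMl // => Hj.
  apply: ler_of_mul_self => //; first by rewrite mulr_ge0 // ltW.
  rewrite (le_trans (dist_sq j)) //.
  rewrite [leRHS](_ : _ = 2 * t j * (e / 2 * `|p j - s|)); last by field.
  by rewrite ler_pM2l // mulr_gt0.
Qed.

Lemma regular_subdiff_indicator (s v : 'rV[R]_m) :
  regular_subdiff (indicator D) s v -> limiting_normal_cone D s v.
Proof.
have indNy z : (-oo < indicator D z :> \bar R)%E by rewrite /indicator; case: ifP.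
move=> /(regular_subdiffP _ _ indNy)[].
rewrite /edom /= /indicator; case: ifP => // /set_mem Ds _ H.
apply: regular_normal_limiting => // e e0.
have := H e e0; apply: filterS => w + Dw; rewrite mem_set // add0e lee_fin.
by rewrite subr_le0.
Qed.

End normals.

(** * The augmented Lagrangian *)

Section product_convergence.
Context {T U : topologicalType} (u_ : nat -> T * U) (p : T * U).
Hypothesis uu : u_ j @[j --> \oo] --> p.

Lemma cvg_pair_fst : (u_ j).1 @[j --> \oo] --> p.1.
Proof. exact: cvg_comp uu (@cvg_fst _ _ _ (nbhs p.2) _). Qed.

Lemma cvg_pair_snd : (u_ j).2 @[j --> \oo] --> p.2.
Proof. exact: cvg_comp uu (@cvg_snd _ _ (nbhs p.1) _ _). Qed.

End product_convergence.

Section augmented_lagrangian.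
Context {R : realType} {n m : nat}.
Variables (f : 'rV[R]_n -> R) (g : 'rV[R]_n -> \bar R).
Variables (c : 'rV[R]_n -> 'rV[R]_m) (D : set 'rV[R]_m).
Hypothesis f_diff : forall x, differentiable f x.
Hypothesis f_C1 : continuous (grad f).
Hypothesis c_diff : forall x, differentiable c x.
Hypothesis c_C1 : continuous (jacobian c).
Hypothesis g_gtNy : forall x, (-oo < g x)%E.
Hypothesis D_closed : closed D.

Local Notation q := (objective f g).

Lemma objectiveE : q = (fun x => g x + (f x)%:E)%E.
Proof. by apply/funext => x; rewrite /objective addeC. Qed.

Lemma indicator_gtNy z : (-oo < indicator D z :> \bar R)%E.
Proof. by rewrite /indicator; case: ifP. Qed.

Lemma aug_lagrangianE mu x s y : aug_lagrangian q c D mu x s y =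
  (g x + indicator D s + (f x + penalty mu y (c x - s))%:E)%E.
Proof. by rewrite /aug_lagrangian /objective -!addeA addeC -!addeA -EFinD [(_ + f x)%R]addrC. Qed.

Lemma aug_lagrangian_in mu x s y : D s ->
  aug_lagrangian q c D mu x s y = (g x + (f x + penalty mu y (c x - s))%:E)%E.
Proof. by move=> Ds; rewrite aug_lagrangianE /indicator mem_set // adde0. Qed.

Lemma aug_lagrangian_gtNy mu x s y : (-oo < aug_lagrangian q c D mu x s y)%E.
Proof.
rewrite aug_lagrangianE; apply: addEFin_gtNy.
by rewrite /indicator; case: ifP => _; rewrite ?adde0 //; case: (g x) (g_gtNy x).
Qed.

Lemma aug_lagrangian_dom mu x s y :
  (aug_lagrangian q c D mu x s y < +oo)%E -> (g x \is a fin_num)%E /\ D s.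
Proof.
rewrite aug_lagrangianE /indicator.
have := g_gtNy x; case: ifP => [/set_mem Ds|_]; case: (g x) => //=.
Qed.

(** The penalty contributes the updated multiplier [lam = y + (c x - s) / mu]
    to both blocks, through [(nabla c x)^T] in the first and with the opposite
    sign in the second.  Taking [b + lam] as the normal makes [lam] cancel. *)
Lemma regular_aug_lagrangian_M_map mu y (w eta : 'rV[R]_(n + m)) :
  regular_subdiff
    (fun w => aug_lagrangian q c D mu (lsubmx w) (rsubmx w) y) w eta ->
  M_map g c D (lsubmx w) (c (lsubmx w) - rsubmx w)
    (lsubmx eta - grad f (lsubmx w) + jacT_mul c (lsubmx w) (rsubmx eta)).
Proof.
set L := fun _ => _ => Heta.
have LNy z : (-oo < L z)%E by exact: aug_lagrangian_gtNy.
have [gfin Ds] : (g (lsubmx w) \is a fin_num)%E /\ D (rsubmx w).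
  by case: Heta => Hw _; exact: aug_lagrangian_dom Hw.
have := regular_subdiff_lslice LNy Heta.
have := regular_subdiff_rslice LNy Heta.
move: (lsubmx w) (rsubmx w) gfin Ds => x s gfin Ds.
set a := lsubmx eta; set b := rsubmx eta.
set lam := y + mu^-1 *: (c x - s).
have -> : (fun z => L (row_mx x z)) = (fun z => indicator D z +
    (fine (g x) + f x + penalty mu y (c x - z))%:E)%E.
  apply/funext => z; rewrite /L row_mxKl row_mxKr aug_lagrangianE -{1}(fineK gfin).
  by rewrite addeAC addeC -EFinD addrA.
have -> : (fun z => L (row_mx z s)) =
    (fun z => g z + (f z + penalty mu y (c z - s))%:E)%E.
  by apply/funext => z; rewrite /L row_mxKl row_mxKr aug_lagrangian_in.
move=> Hs Hx.
have cst_grad : has_gradient (fun=> fine (g x) + f x) s 0.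
  by move=> e e0; near=> z; rewrite subrr dotC dot0r subr0 normr0 mulr_ge0 // ltW.
have {}Hs := regular_subdiff_sub indicator_gtNy
  (has_gradient_add cst_grad (has_gradient_penalty_slack mu y (c x) s)) Hs.
have {}Hx := regular_subdiff_sub g_gtNy (has_gradient_add
  (grad_has_gradient (f_diff x))
  (has_gradient_comp (c_diff x) (has_gradient_penalty mu y s (c x)))) Hx.
exists (a - (grad f x + jacT_mul c x lam)); first exact: regular_sub_limiting.
exists (b + lam).
  rewrite (subKr (c x) s).
  apply: (regular_subdiff_indicator D_closed).
  by move: Hs; rewrite add0r opprK.
by rewrite /jacT_mul (mulmxDl b) opprD (addrA a) addrACA addNr addr0.
Unshelve. all: by end_near. Qed.

(** The value of [g] is a separate coordinate so that convergence in the
    product space includes the requirement that [g (x_ j)] tend to [g x],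
    which is not implied by that of [x_ j]. *)
Definition M_graph : set ('rV[R]_n * \bar R * 'rV[R]_m * 'rV[R]_n) :=
  [set p | M_map g c D p.1.1.1 p.1.2 p.2 /\ p.1.1.2 = g p.1.1.1].

Lemma cvg_jacT_mul (T : Type) (F : set_system T) {FF : Filter F}
    (x_ : T -> 'rV[R]_n) x (y_ : T -> 'rV[R]_m) y :
  x_ t @[t --> F] --> x -> y_ t @[t --> F] --> y ->
  jacT_mul c (x_ t) (y_ t) @[t --> F] --> jacT_mul c x y.
Proof.
move=> xx yy; apply: cvg_mulmx_tr => //.
exact: (cvg_comp _ _ xx (c_C1 (x := x))).
Qed.

Lemma cvg_grad (T : Type) (F : set_system T) {FF : Filter F}
    (x_ : T -> 'rV[R]_n) x :
  x_ t @[t --> F] --> x -> grad f (x_ t) @[t --> F] --> grad f x.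
Proof. by move=> xx; exact: (cvg_comp _ _ xx (f_C1 (x := x))). Qed.

Lemma cvg_f (T : Type) (F : set_system T) {FF : Filter F}
    (x_ : T -> 'rV[R]_n) x :
  x_ t @[t --> F] --> x -> f (x_ t) @[t --> F] --> f x.
Proof.
move=> xx.
exact: (cvg_comp _ _ xx (differentiable_continuous (f_diff x))).
Qed.

Lemma cvg_c (T : Type) (F : set_system T) {FF : Filter F}
    (x_ : T -> 'rV[R]_n) x :
  x_ t @[t --> F] --> x -> c (x_ t) @[t --> F] --> c x.
Proof.
move=> xx.
exact: (cvg_comp _ _ xx (differentiable_continuous (c_diff x))).
Qed.

Lemma closure_M_graph_cvg (x_ : nat -> 'rV[R]_n) (z_ : nat -> 'rV[R]_m)
    (v_ : nat -> 'rV[R]_n) x z v :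
  (forall j, closure M_graph (x_ j, g (x_ j), z_ j, v_ j)) ->
  x_ j @[j --> \oo] --> x -> g (x_ j) @[j --> \oo] --> g x ->
  z_ j @[j --> \oo] --> z -> v_ j @[j --> \oo] --> v ->
  closure M_graph (x, g x, z, v).
Proof.
move=> clM xx gg zz vv.
have cl : closed (closure M_graph) by exact: closed_closure.
have := @closed_cvg _ _ \oo _ _ _ cl (nearW _ clM); apply.
exact: (cvg_pair (cvg_pair (cvg_pair xx gg) zz) vv).
Qed.

Lemma limiting_aug_lagrangian_closure mu y (x : 'rV[R]_n) s
    (eta : 'rV[R]_(n + m)) :
  limiting_subdiff
    (fun w => aug_lagrangian q c D mu (lsubmx w) (rsubmx w) y)
    (row_mx x s) eta ->
  closure M_graph (x, g x, c x - s,
    lsubmx eta - grad f x + jacT_mul c x (rsubmx eta)).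
Proof.
set L := fun _ => _ => -[Hdom [w_ [e_ [ww Lw Hw ee]]]].
have [gfin Ds] : (g x \is a fin_num)%E /\ D s.
  by move: Hdom; rewrite /edom /= /L row_mxKl row_mxKr; exact: aug_lagrangian_dom.
have xx : lsubmx (w_ j) @[j --> \oo] --> x.
  rewrite -[X in _ --> X](row_mxKl x s).
  exact: (cvg_comp _ _ ww (@continuous_lsubmx R 1 n m _)).
have ss : rsubmx (w_ j) @[j --> \oo] --> s.
  rewrite -[X in _ --> X](row_mxKr x s).
  exact: (cvg_comp _ _ ww (@continuous_rsubmx R 1 n m _)).
have aa : lsubmx (e_ j) @[j --> \oo] --> lsubmx eta.
  exact: (cvg_comp _ _ ee (@continuous_lsubmx R 1 n m _)).
have bb : rsubmx (e_ j) @[j --> \oo] --> rsubmx eta.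
  exact: (cvg_comp _ _ ee (@continuous_rsubmx R 1 n m _)).
have zz : c (lsubmx (w_ j)) - rsubmx (w_ j) @[j --> \oo] --> (c x - s : 'rV[R]_m).
  exact: cvgB (cvg_c xx) ss.
(* On the domain of [L] the indicator vanishes, so [g] is [L] minus a
   continuous function and inherits the convergence of the values of [L]. *)
have gg : g (lsubmx (w_ j)) @[j --> \oo] --> g x.
  pose P x s := f x + penalty mu y (c x - s).
  have LE j : g (lsubmx (w_ j)) =
      (L (w_ j) - (P (lsubmx (w_ j)) (rsubmx (w_ j)))%:E)%E.
    have [/aug_lagrangian_dom[_ Dj] _] := Hw j.
    by rewrite /L aug_lagrangian_in // addeK.
  have LxE : g x = (L (row_mx x s) - (P x s)%:E)%E.
    by rewrite /L row_mxKl row_mxKr aug_lagrangian_in // addeK.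
  under [X in X @ _]eq_fun do rewrite LE.
  rewrite LxE; apply: cvgeB => //.
    by rewrite -EFinN fin_num_adde_defl.
  apply: cvg_EFin; first exact: nearW.
  rewrite /P /penalty; apply: cvgD; first exact: cvg_f.
  apply: cvgD; first by apply: cvg_dot => //; exact: cvg_cst.
  rewrite enorm_sqr; under [X in X @ _]eq_fun do rewrite enorm_sqr.
  by apply: cvgMr; exact: cvg_dot.
apply: closure_M_graph_cvg xx gg zz
  (cvgD (cvgB aa (cvg_grad xx)) (cvg_jacT_mul xx bb)) => j.
apply: subset_closure; split=> //=.
exact: regular_aug_lagrangian_M_map (Hw j).
Qed.

Lemma AM_regular_closure x v :
  AM_regular f g c D x -> closure M_graph (x, g x, 0, v) -> M_map g c D x 0 v.
Proof.
move=> [_ AM] /closure_cvg_seq[u_ [uM uu]]; apply: AM.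
exists (fun j => (u_ j).1.1.1), (fun j => (u_ j).1.2), (fun j => (u_ j).2).
have u1 := cvg_pair_fst uu; have u11 := cvg_pair_fst u1.
split.
- by move=> j; have [] := uM j.
- exact: cvg_pair_snd uu.
- exact: cvg_pair_fst u11.
- have -> : (fun j => g (u_ j).1.1.1) = (fun j => (u_ j).1.1.2).
    by apply/funext => j; have [_ ->] := uM j.
  exact: cvg_pair_snd u11.
- exact: cvg_pair_snd u1.
Qed.

(** Continuity of [f] preserves the attentive convergence of values, and
    continuity of [grad f] the convergence of subgradients. *)
Lemma limiting_subdiff_objective x v :
  limiting_subdiff g x v -> limiting_subdiff q x (v + grad f x).
Proof.
rewrite objectiveE => -[gx [x_ [v_ [xx gg Hv vv]]]]; split.
  by rewrite /edom /= lte_add_pinfty // ltry.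
exists x_, (fun j => v_ j + grad f (x_ j)); split=> //.
- apply: cvgeD => //; first by rewrite fin_num_adde_defl.
  by apply: cvg_EFin; [exact: nearW|exact: cvg_f].
- move=> j; apply: regular_subdiff_add => //.
  exact: grad_has_gradient.
- by apply: cvgD => //; exact: cvg_grad.
Qed.

Lemma AM_regular_stationary x :
  AM_regular f g c D x -> closure M_graph (x, g x, 0, - grad f x) ->
  M_stationary q c D x.
Proof.
move=> AM /(AM_regular_closure AM)[u gu [y]]; rewrite subr0 => Ny uy.
split; first by case: AM.
exists y; split=> //.
have -> : - jacT_mul c x y = u + grad f x.
  by rewrite -[grad f x]opprK -uy opprD addrA subrr add0r.
exact: limiting_subdiff_objective.
Qed.

End augmented_lagrangian.

Theorem corollary3p5 (R : realType) (n m : nat)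
  (f : 'rV[R]_n -> R) (c : 'rV[R]_n -> 'rV[R]_m)
  (g : 'rV[R]_n -> \bar R) (D : set 'rV[R]_m)
  (f_diff : forall x, differentiable f x)
  (f_C1 : continuous (grad f))
  (f_lip : locally_lipschitz (grad f))
  (c_diff : forall x, differentiable c x)
  (c_C1 : continuous (jacobian c))
  (c_lip : locally_lipschitz (jacobian c))
  (g_gtNy : forall x, (-oo < g x)%E)
  (g_proper : proper_fun g)
  (g_lsc : lower_semicontinuous g)
  (g_prox : prox_bounded g)
  (D_nonempty : D !=set0)
  (D_closed : closed D)
  (mu0 theta kappa : R) (Y : set 'rV[R]_m)
  (mu0_gt0 : 0 < mu0)
  (theta01 : 0 < theta < 1)
  (kappa01 : 0 < kappa < 1)
  (Y_nonempty : Y !=set0)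
  (Y_bounded : bounded_set Y)
  (mu eps : nat -> R) (yhat y : nat -> 'rV[R]_m)
  (x : nat -> 'rV[R]_n) (s : nat -> 'rV[R]_m)
  (run : AL_run (objective f g) c D mu0 theta kappa Y mu eps yhat y x s)
  (eps_to0 : eps k @[k --> \oo] --> (0 : R))
  (xs : 'rV[R]_n)
  (xs_acc : cluster ((x k, s k) @[k --> \oo]) (xs, c xs))
  (xs_feas : feasible (objective f g) c D xs)
  (phi : nat -> nat)
  (phi_incr : increasing_seq phi)
  (x_sub : x (phi k) @[k --> \oo] --> xs)
  (q_sub : objective f g (x (phi k)) @[k --> \oo] --> objective f g xs)
  (s_sub : s (phi k) @[k --> \oo] --> c xs)
  (xs_AM : AM_regular f g c D xs) :
  M_stationary (objective f g) c D xs.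
Proof.
apply: AM_regular_stationary => //.
have /choice[eta etaP] : forall k, exists e : 'rV[R]_(n + m),
    limiting_subdiff (fun w => aug_lagrangian (objective f g) c D (mu k)
      (lsubmx w) (rsubmx w) (yhat k)) (row_mx (x k) (s k)) e /\ enorm e <= eps k.
  by move=> k; have [e] := AL_stationary run k; exists e.
have phi_oo : phi k @[k --> \oo] --> \oo.
  apply/cvgnyPge => A; exists A => // k /= Ak.
  apply: leq_trans Ak _; elim: k => // k; move/leq_ltn_trans; apply.
  by rewrite ltnNge -leEnat phi_incr -ltnNge.
have eta0 : eta (phi k) @[k --> \oo] --> (0 : 'rV[R]_(n + m)).
  apply/cvgrPdist_le => e e0.
  have /cvgrPdist_le/(_ e e0) := cvg_comp _ _ phi_oo eps_to0.
  apply: filterS => k; rewrite !sub0r !normrN => epsk.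
  apply: le_trans (norm_le_enorm _) _; have [_ /le_trans] := etaP (phi k); apply.
  exact: le_trans (ler_norm _) epsk.
have l0 : lsubmx (eta (phi k)) @[k --> \oo] --> (0 : 'rV[R]_n).
  rewrite (_ : 0 = lsubmx (0 : 'rV[R]_(n + m))); last by rewrite linear0.
  exact: (cvg_comp _ _ eta0 (@continuous_lsubmx R 1 n m _)).
have r0 : rsubmx (eta (phi k)) @[k --> \oo] --> (0 : 'rV[R]_m).
  rewrite (_ : 0 = rsubmx (0 : 'rV[R]_(n + m))); last by rewrite linear0.
  exact: (cvg_comp _ _ eta0 (@continuous_rsubmx R 1 n m _)).
have g_sub : g (x (phi k)) @[k --> \oo] --> g xs.
  have gE z : g z = (objective f g z - (f z)%:E)%E.
    by rewrite objectiveE addeK.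
  rewrite gE; under [X in X @ _]eq_fun do rewrite gE.
  apply: cvgeB => //; first by rewrite -EFinN fin_num_adde_defl.
  by apply: cvg_EFin; [exact: nearW|exact: cvg_f].
have z0 : c (x (phi k)) - s (phi k) @[k --> \oo] --> (0 : 'rV[R]_m).
  by rewrite -(subrr (c xs)); apply: cvgB => //; exact: cvg_c.
have v0 : lsubmx (eta (phi k)) - grad f (x (phi k)) +
    jacT_mul c (x (phi k)) (rsubmx (eta (phi k))) @[k --> \oo] --> - grad f xs.
  rewrite -[X in _ --> X]addr0 -[X in _ + X](mul0mx _ ('J c xs)^T) -[X in X + _]add0r.
  by apply: cvgD; [apply: cvgB => //; exact: cvg_grad|exact: cvg_jacT_mul].
apply: closure_M_graph_cvg x_sub g_sub z0 v0 => k; have [Hk _] := etaP (phi k).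
exact: limiting_aug_lagrangian_closure Hk.
Qed.
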